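(* Let $\alpha > 0$ be a fixed real number, let $\varepsilon, C, n, d$ satisfy $d \ge 2\log n$, $0 \le \varepsilon \le (\log n)^{-(C-1)}$, $C \ge \max\{28\alpha+3,\, 56\alpha+1\}$, and let $n$ be large enough (in terms of $\alpha$ and $C$). Let $c = \frac{C(C-1)}{C-28\alpha-1}$. Suppose that $G$ is an $n$-vertex graph with $\Delta(G)\le d$ and $d(G)\ge d(1-\varepsilon)$. Then there is a collection $\mathcal{H}$ of pairwise vertex-disjoint subgraphs of $G$ such that every $H\in\mathcal{H}$ is a $(\frac18, c, s_H)$-expander satisfying $d(H)\ge d(1-\varepsilon_H)$ and $\delta(H)\ge d(H)/2$, where $s_H := \frac{d}{4(\log|V(H)|)^c}$ and $\varepsilon_H := (\log|V(H)|)^{-(C-28\alpha-1)}$. Moreover, $$\sum_{H\in\mathcal{H}}|V(H)| \ge \left(1-\frac{(\log\log\log n)^2}{(\log\log n)^{\alpha}}\right)n.$$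
   Context: All graphs are finite and simple, and logarithms are base $2$. For a graph $G$, $d(G)$, $\delta(G)$, $\Delta(G)$ denote its average, minimum and maximum degree. For $X\subseteq V(G)$, $N_G(X)$ is the set of vertices outside $X$ adjacent to at least one vertex of $X$. For $F\subseteq E(H)$, $H-F$ is $H$ with the edges of $F$ deleted. A graph $H$ is an $(\varepsilon,c,s)$-expander if for every $U\subseteq V(H)$ and $F\subseteq E(H)$ with $1\le|U|\le\frac23|V(H)|$ and $|F|\le s|U|$ we have $|N_{H-F}(U)|\ge\frac{\varepsilon}{(\log|V(H)|)^c}\cdot|U|$. *)

(* Defs.v *)
From HB Require Import structures.
From mathcomp Require Import all_boot all_order all_algebra.
From mathcomp Require Import reals exp.

Set Implicit Arguments.
Unset Strict Implicit.
Unset Printing Implicit Defensive.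

Import Order.TTheory GRing.Theory Num.Theory.

Local Open Scope ring_scope.

Section Graph.
Variable T : finType.

(* A finite simple graph whose vertices are drawn from the universe T: a vertex
   set together with a set of edges, each edge being a 2-element set of
   vertices.  The vertex set need not be all of T, so that a graph and its
   (not necessarily induced) subgraphs live in the same finite type. *)
Record sgraph := SGraph {
  sgraph_val : {set T} * {set {set T}};
  _ : [forall e in sgraph_val.2, (e \subset sgraph_val.1) && (#|e| == 2%N)] }.

HB.instance Definition _ := [isSub for sgraph_val].
HB.instance Definition _ := [Finite of sgraph by <:].

Definition vertices (G : sgraph) : {set T} := (sgraph_val G).1.
Definition edges (G : sgraph) : {set {set T}} := (sgraph_val G).2.

Lemma edgesP (G : sgraph) (e : {set T}) :
  e \in edges G -> e \subset vertices G /\ #|e| = 2%N.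
Proof.
by case: G => -[V E] /= GP eE; have /andP[? /eqP] := forall_inP GP _ eE.
Qed.

Definition subgraph (H G : sgraph) : bool :=
  (vertices H \subset vertices G) && (edges H \subset edges G).

Definition degree (G : sgraph) (v : T) : nat :=
  #|[set e in edges G | v \in e]|.

Definition max_degree (G : sgraph) : nat :=
  \max_(v in vertices G) degree G v.

(* The default value #|vertices G| exceeds every degree, so it only matters
   when G has no vertex. *)
Definition min_degree (G : sgraph) : nat :=
  \big[minn/#|vertices G|]_(v in vertices G) degree G v.

Definition avg_degree (R : realType) (G : sgraph) : R :=
  (\sum_(v in vertices G) degree G v)%:R / #|vertices G|%:R.

Definition nbhd (G : sgraph) (X : {set T}) : {set T} :=
  [set v in vertices G :\: X | [exists u in X, [set u; v] \in edges G]].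

Fact del_edges_subproof (H : sgraph) (F : {set {set T}}) :
  [forall e in edges H :\: F, (e \subset vertices H) && (#|e| == 2%N)].
Proof.
by apply/forall_inP => e /setDP[/edgesP[-> ->]].
Qed.

Definition del_edges (H : sgraph) (F : {set {set T}}) : sgraph :=
  @SGraph (vertices H, edges H :\: F) (del_edges_subproof H F).

End Graph.

Arguments avg_degree {T} R G.

Definition log2 (R : realType) (x : R) : R := ln x / ln 2.

Definition expander (R : realType) (eps c s : R) (T : finType)
    (H : sgraph T) : Prop :=
  forall (U : {set T}) (F : {set {set T}}),
    U \subset vertices H -> F \subset edges H ->
    (1 <= #|U|)%N -> #|U|%:R <= 2 / 3 * #|vertices H|%:R :> R ->
    #|F|%:R <= s * #|U|%:R ->
    eps / (log2 #|vertices H|%:R `^ c) * #|U|%:R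
      <= #|nbhd (del_edges H F) U|%:R.

(* Main.v *)
Require Import Defs.
From mathcomp Require Import all_boot all_order all_algebra.
From mathcomp Require Import reals exp.
From mathcomp Require Import boolp ring lra.
Import Order.TTheory GRing.Theory Num.Theory.
Local Open Scope ring_scope.

Set Implicit Arguments.
Unset Strict Implicit.

(** Almost all of a nearly regular graph is covered by disjoint expanders
because an induced subgraph that maximises a suitable density is automatically
an expander, and removing it hardly damages what is left.

Write G[S] for the subgraph induced on S, D(S) for its average degree, and
f(S) = d |S| - 2 e(S) for its deficiency, which is nonnegative as no degree
exceeds d.  Call S log-densest for lam when it maximises D(A) - lam log |A|
over its nonempty subsets A.  Such a set has two properties:
- Deleting a vertex of degree below D(S) / 2 would raise the density, so the
  minimum degree is at least half of the average degree
  ([log_densest_min_degree]).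
- If deleting few edges F leaves U with a small neighbourhood N, then G[S]
  falls apart into U, N and the rest W, at a small loss of edges.  Neither part
  is denser than S, and U, having at most 2/3 of the vertices, is sparser by
  lam / 2.  So the loss is at least lam |U| / 4 edges, and hence F or N is large
  ([log_densest_expander]).

Let l = log |S|.  The packing of [log_densest_packing] repeatedly removes a
log-densest subset B from the remaining set R.  By maximality
f(B) / |B| exceeds f(R) / |R| by at most lam log |R|.  There are at most
f(B) edges between B and R \ B, so removing B raises f(R) by at most f(B), and
(f(R) + mu |R|) |R| never increases, where mu bounds lam log |R|.  Take
lam = 2 d l^(-C), so that mu is of order d l^(1 - C), and stop when a fraction
l^(-alpha) of S is left.  Then every piece satisfies
f(B) <= 3 d l^(1 - C + 2 alpha) |B|, well below d l^(-b) |B| for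
b = C - 28 alpha - 1.

With rho = b / (C - 1) < 1, a piece B with log |B| >= l^rho has all the
required properties, since c rho = C.  For a smaller piece, l^(-b) is at most
(log |B|)^(-(C - 1)), so that B satisfies the hypothesis that S did, and the
argument recurs inside B ([exists_good_parts]).  Since log |B| drops to a power
rho of l from one stage to the next, the successive losses (log |B|)^(-alpha)
at least double, and their total is at most twice the last one.  Every piece has
at least d / 2 vertices, because its average degree is that large; so
log |B| >= log log n throughout, and all losses sum to at most
2 (log log n)^(-alpha). *)

(** * Counting edges of induced subgraphs *)

Section Counting.
Variable T : finType.
Implicit Types (G H : sgraph T) (R S U N : {set T}) (F : {set {set T}}).

Fact induced_subproof G S :
  [forall e in [set e in edges G | e \subset S],
     (e \subset S) && (#|e| == 2%N)].
Proof.
by apply/forall_inP => e; rewrite inE => /andP[/edgesP[_ ->] ->].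
Qed.

Definition induced G S : sgraph T :=
  @SGraph T (S, [set e in edges G | e \subset S]) (induced_subproof G S).

Definition edge_count G S : nat := #|edges (induced G S)|.

Lemma mem_edges_induced G S e :
  (e \in edges (induced G S)) = (e \in edges G) && (e \subset S).
Proof. by rewrite inE. Qed.

Lemma subgraph_induced G S : S \subset vertices G -> subgraph (induced G S) G.
Proof.
move=> sSG; rewrite /subgraph sSG; apply/subsetP => e.
by rewrite mem_edges_induced => /andP[].
Qed.

Lemma edge_countE G S :
  edge_count G S = (\sum_(e in edges G) (e \subset S))%N.
Proof.
rewrite /edge_count -sum1_card big_mkcond [RHS]big_mkcond /=.
apply: eq_bigr => e _; rewrite mem_edges_induced.
by case: (e \in _); case: (e \subset S).
Qed.

Lemma edge_count0 G : edge_count G set0 = 0%N.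
Proof.
rewrite edge_countE big1 // => e /edgesP[_ e2].
by rewrite subset0 -cards_eq0 e2.
Qed.

Lemma sum_degree G S :
  (\sum_(v in S) degree G v = \sum_(e in edges G) #|e :&: S|)%N.
Proof.
transitivity (\sum_(v in S) \sum_(e in edges G) (v \in e : nat))%N.
  apply: eq_bigr => v _; rewrite /degree -sum1_card big_mkcond [RHS]big_mkcond.
  by apply: eq_bigr => e _; rewrite inE; case: (e \in _); case: (v \in e).
rewrite exchange_big; apply: eq_bigr => e _.
rewrite -sum1_card big_mkcond [RHS]big_mkcond.
by apply: eq_bigr => v _; rewrite inE andbC; case: (v \in S); case: (v \in e).
Qed.

Lemma handshake G : (\sum_(v in vertices G) degree G v = 2 * #|edges G|)%N.
Proof.
rewrite sum_degree -sum1_card big_distrr /=; apply: eq_bigr => e /edgesP[eG e2].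
by rewrite (setIidPl eG) e2.
Qed.

Lemma degree_le_vertices G v : (degree G v <= #|vertices G|)%N.
Proof.
apply: leq_trans (leq_imset_card (fun u => [set v; u]) (vertices G)).
apply/subset_leq_card/subsetP => e; rewrite inE.
case/andP=> /edgesP[eG /eqP e2] ve.
have [x [y [xy exy]]] := cards2P _ e2.
move: ve eG; rewrite exy !inE => /orP[]/eqP-> /subsetP sG.
  by apply/imsetP; exists y => //; apply: sG; rewrite !inE eqxx orbT.
apply/imsetP; exists x; last by rewrite setUC.
by apply: sG; rewrite !inE eqxx.
Qed.

(** An edge inside S has both ends counted by the degree sum, and an edge from S
to R \ S has one: this is what makes the cost of cutting S off at most the
deficiency of S. *)
Lemma edge_count_setD G R S : S \subset R ->
  (edge_count G R + edge_count G S
     <= edge_count G (R :\: S) + \sum_(v in S) degree G v)%N.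
Proof.
move=> sSR; rewrite sum_degree !edge_countE -!big_split /=.
apply: leq_sum => e /edgesP[_ e2].
have [eS|neS] := boolP (e \subset S).
  rewrite (subset_trans eS sSR) (setIidPl eS) e2.
  exact: leq_addl.
rewrite addn0 subsetD.
have [eR|//] := boolP (e \subset R).
case: (set_0Vmem (e :&: S)) => [/eqP eS0|[x xeS]].
  by rewrite -setI_eq0 eS0.
by rewrite addnC ltn_addr // card_gt0; apply/set0Pn; exists x.
Qed.

Lemma edge_count_setD1 G S v :
  edge_count G S = (edge_count G (S :\ v) + degree (induced G S) v)%N.
Proof.
rewrite /edge_count
  -(cardsID [set e : {set T} | v \in e] (edges (induced G S))).
rewrite addnC.
congr (_ + _)%N; apply: eq_card => e.
  by rewrite !inE subsetD1 andbC -andbA.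
by rewrite !inE.
Qed.

(** An edge that avoids F and N cannot leave U, since its other end would be a
neighbour of U. *)
Lemma edge_count_cut G S U F N : U \subset S ->
  N = nbhd (del_edges (induced G S) F) U ->
  (edge_count G S <= edge_count G U + edge_count G (S :\: (U :|: N))
                     + #|F| + \sum_(v in N) degree G v)%N.
Proof.
move=> sUS defN.
have -> : #|F| = (\sum_(e in edges G) (e \in F) + #|F :\: edges G|)%N.
  rewrite -(cardsID (edges G) F); congr (_ + _)%N.
  rewrite -sum1_card big_mkcond [RHS]big_mkcond; apply: eq_bigr => e _.
  by rewrite !inE andbC; case: (e \in edges G); case: (e \in F).
rewrite addnA addnAC; apply: leq_trans (leq_addr _ _).
rewrite sum_degree !edge_countE -!big_split /=.
apply: leq_sum => e eG; have [_ e2] := edgesP eG.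
have [eS|//] := boolP (e \subset S).
have [//|eU] := boolP (e \subset U).
have [_|eF] := boolP (e \in F); first by rewrite addnAC addnC.
case: (set_0Vmem (e :&: N)) => [eN0|[x xeN]]; last first.
  by rewrite addnC ltn_addr // card_gt0; apply/set0Pn; exists x.
suff -> : e \subset S :\: (U :|: N) by rewrite add0n -!addnA.
rewrite subsetD eS -setI_eq0 setIUr eN0 setU0.
apply/eqP/setP => u; rewrite [RHS]inE; apply/negP; rewrite inE => /andP[ue uU].
have [w we wU] := subsetPn eU.
have uw : u != w by apply: contraNneq wU => <-.
have ew : e = [set u; w].
  apply/esym/eqP; rewrite eqEcard e2 cards2 uw andbT.
  by rewrite subUset !sub1set ue.
have : w \in e :&: N.
  rewrite inE we defN inE inE wU (subsetP eS) //=.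
  by apply/existsP; exists u; rewrite uU -ew !inE eF eG eS.
by rewrite eN0 inE.
Qed.

End Counting.

(** * Binary logarithms and real powers *)

Section Logarithm.
Variable R : realType.
Implicit Types (x y : R).

Lemma ln2_gt0 : 0 < ln 2 :> R.
Proof. by apply: ln_gt0; lra. Qed.

Lemma ler_log2 x y : 0 < x -> x <= y -> log2 x <= log2 y.
Proof.
move=> x0 xy; rewrite ler_pM2r ?invr_gt0 ?ln2_gt0 //.
by rewrite ler_ln ?posrE // (lt_le_trans x0).
Qed.

Lemma log2_ge0 x : 1 <= x -> 0 <= log2 x.
Proof. by move=> x1; apply: divr_ge0; [apply: ln_ge0|apply: ltW ln2_gt0]. Qed.

Lemma log2_pow2 k : log2 (2 ^+ k) = k%:R :> R.
Proof.
by rewrite /log2 lnXn // -[_ *+ k]mulr_natl mulfK // gt_eqF // ln2_gt0.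
Qed.

(** The case m = 0 is covered because ln 0 = 0. *)
Lemma ler_log2_nat (m n : nat) : (m <= n)%N -> log2 m%:R <= log2 n%:R :> R.
Proof.
case: m => [_|m mn]; last by rewrite ler_log2 // ?ltr0n // ler_nat.
rewrite {1}/log2 ln0 ?mul0r //; case: n => [|n].
  by rewrite /log2 ln0 ?mul0r.
by rewrite log2_ge0 ?ler1n.
Qed.

Lemma log2_nat_gt0 (n : nat) : 0 < log2 n%:R :> R -> (1 < n)%N.
Proof.
case: n => [|[|n]] //; rewrite /log2 ?ln1 ?mul0r ?ltxx //.
by rewrite ln0 ?mul0r ?ltxx.
Qed.

(** log (3/2) >= 1/2, because (3/2)^2 >= 2. *)
Lemma log2_le_sub x y : 0 < x -> x <= 2 / 3 * y -> log2 x <= log2 y - 1 / 2.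
Proof.
move=> x0 xy; have y0 : 0 < y by lra.
have ln32 : ln 2 <= 2 * ln (3 / 2) :> R.
  have -> : 2 * ln (3 / 2) = ln ((3 / 2) ^+ 2) :> R.
    by rewrite lnXn ?mulr_natl //; lra.
  by rewrite ler_ln ?posrE; lra.
have : ln (3 / 2 * x) <= ln y by rewrite ler_ln ?posrE; lra.
rewrite lnM ?posrE //; last by lra.
have l2 := ln2_gt0; move=> h; rewrite /log2.
have -> : ln y / ln 2 - 1 / 2 = (ln y - ln 2 / 2) / ln 2.
  by field; rewrite gt_eqF.
by rewrite ler_pM2r ?invr_gt0 //; lra.
Qed.

End Logarithm.

Section Powers.
Variable R : realType.
Implicit Types (a x y l : R).

Lemma powRN_le a x y : 0 <= a -> 0 < x -> x <= y -> y `^ (- a) <= x `^ (- a).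
Proof.
move=> a0 x0 xy; have y0 := lt_le_trans x0 xy.
rewrite !powRN lef_pV2 ?posrE ?powR_gt0 //.
by apply: ge0_ler_powR; rewrite ?nnegrE // ltW.
Qed.

Lemma powRN_le_quarter a l : 4 <= l -> 1 <= a -> l `^ (- a) <= 1 / 4.
Proof.
move=> l4 a1; apply: (@le_trans _ _ (l `^ (- 1))).
  by apply: ler_powR; lra.
rewrite powR_inv1; last by lra.
by rewrite mul1r lef_pV2 ?posrE //; lra.
Qed.

Lemma powR_large a x : 0 < a ->
  exists L, forall l, L <= l -> x <= l `^ a.
Proof.
move=> a0; have m1 : 1 <= Num.max x 1 by rewrite le_max lexx orbT.
have m0 : 0 < Num.max x 1 by lra.
exists (Num.max x 1 `^ a^-1) => l Ll.
have L0 : 0 < Num.max x 1 `^ a^-1 by rewrite powR_gt0.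
apply: (@le_trans _ _ ((Num.max x 1 `^ a^-1) `^ a)).
  by rewrite -powRrM mulVf ?gt_eqF // powRr1 ?(ltW m0) // le_max lexx.
by apply: ge0_ler_powR; rewrite ?nnegrE //; lra.
Qed.

(** What a stage at scale l = log |S| needs: its loss l^(-alpha) is at most half
of the loss at the next scale, which is at most l^(b / (C - 1)); and its pieces
B, for which f(B) / (d |B|) is at most 3 l^(1 - C + 2 alpha), have
f(B) / (d |B|) at most l^(-b). *)
Lemma stage_scale (alpha C b : R) : 0 < alpha -> 0 <= b -> b < C - 1 ->
  b = C - 28 * alpha - 1 ->
  exists L, forall l, L <= l ->
    [/\ 4 <= l, 2 * l `^ (- alpha) <= l `^ (- (alpha * (b / (C - 1)))) &
        3 * l `^ (1 - C + 2 * alpha) <= l `^ (- b)].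
Proof.
move=> alpha0 b0 bC defb; set rho := b / (C - 1).
have C10 : 0 < C - 1 by lra.
have rho1 : rho < 1 by rewrite ltr_pdivrMr // mul1r.
have b1 : 0 < alpha * (1 - rho) by rewrite mulr_gt0 //; lra.
have b2 : 0 < 26 * alpha by lra.
have [L1 h1] := powR_large 2 b1.
have [L2 h2] := powR_large 3 b2.
exists (Num.max 4 (Num.max L1 L2)) => l.
rewrite !ge_max => /and3P[l4 /h1 l1 /h2 l2].
have l0 : l != 0 by rewrite gt_eqF //; lra.
split=> //.
  have -> : - (alpha * rho) = alpha * (1 - rho) + - alpha by ring.
  by rewrite powRD ?l0 ?implybT // ler_wpM2r ?powR_ge0.
have -> : - b = 26 * alpha + (1 - C + 2 * alpha) by rewrite defb; ring.
by rewrite (@powRD _ _ (26 * alpha)) ?l0 ?implybT // ler_wpM2r ?powR_ge0.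
Qed.
End Powers.

(** * Log-densest sets *)

Section Densest.
Variables (R : realType) (T : finType) (G : sgraph T).
Implicit Types (A B S U N W : {set T}) (F : {set {set T}}).

Lemma vertices_induced S : vertices (induced G S) = S.
Proof. by []. Qed.

Lemma avg_degree_inducedM S :
  avg_degree R (induced G S) * #|S|%:R = 2 * (edge_count G S)%:R.
Proof.
have [->|S0] := eqVneq S set0; first by rewrite edge_count0 cards0 !mulr0.
rewrite /avg_degree handshake vertices_induced natrM divfK //.
by rewrite pnatr_eq0 cards_eq0.
Qed.

Lemma avg_degree_ge0 (H : sgraph T) : 0 <= avg_degree R H.
Proof. by rewrite divr_ge0. Qed.

Lemma avg_degree_le_vertices (H : sgraph T) :
  avg_degree R H <= #|vertices H|%:R.
Proof.
rewrite /avg_degree; have [->|V0] := eqVneq #|vertices H| 0%N.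
  by rewrite invr0 mulr0.
rewrite ler_pdivrMr ?ltr0n ?lt0n // -natrM ler_nat -sum_nat_const.
by apply: leq_sum => v _; apply: degree_le_vertices.
Qed.

(** The logarithm favours small sets: a subset of a log-densest S that is smaller
by a constant factor is sparser than S by at least a multiple of lam. *)
Definition log_densest (lam : R) S : Prop :=
  S != set0 /\ forall A, A \subset S -> A != set0 ->
    avg_degree R (induced G A) - lam * log2 #|A|%:R
      <= avg_degree R (induced G S) - lam * log2 #|S|%:R.

(** Dropping the logarithms loses nothing in the right direction, since they
favour A; an empty A is included because a part of a cut may be empty. *)
Lemma log_densest_max lam S A : 0 <= lam -> log_densest lam S ->
  A \subset S ->
  2 * (edge_count G A)%:R <= avg_degree R (induced G S) * #|A|%:R.
Proof.
move=> lam0 [S0 Smax] AS.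
have [->|A0] := eqVneq A set0; first by rewrite edge_count0 cards0 !mulr0.
rewrite -avg_degree_inducedM ler_wpM2r //.
have := Smax _ AS A0.
have := ler_wpM2l lam0 (ler_log2_nat R (subset_leq_card AS)).
lra.
Qed.

(** Otherwise S minus a vertex of smaller degree would have at least the same
average degree and a smaller logarithm. *)
Lemma log_densest_min_degree lam S : 0 <= lam -> log_densest lam S ->
  avg_degree R (induced G S) / 2 <= (min_degree (induced G S))%:R.
Proof.
move=> lam0 Sd; rewrite /min_degree.
have Ds := avg_degree_ge0 (induced G S).
have := avg_degree_le_vertices (induced G S); rewrite vertices_induced => DS.
elim/big_ind: _ => [|m n hm hn|v vS]; first by lra.
  by rewrite /minn; case: ifP.
have := log_densest_max lam0 Sd (subD1set S v).
have := avg_degree_inducedM S.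
rewrite (edge_count_setD1 G S v) (cardsD1 v S) vS !natrD mulrDr mulr1 mulrDr.
lra.
Qed.

Lemma sum_degree_le (d : R) S : S \subset vertices G ->
  (max_degree G)%:R <= d -> (\sum_(v in S) degree G v)%:R <= d * #|S|%:R.
Proof.
move=> SG dG; apply: le_trans (ler_wpM2r (ler0n _ _) dG).
rewrite -natrM ler_nat mulnC -sum_nat_const; apply: leq_sum => v vS.
by apply: leq_bigmax_cond; apply: (subsetP SG).
Qed.

(** Suppose that N is too small, and let W be the rest of S.  Then
2 e(S) <= 2 e(U) + 2 e(W) + 2 |F| + 2 d |N|, whereas maximality gives
2 e(U) <= (D(S) - lam / 2) |U| and 2 e(W) <= D(S) |W|.  The resulting bound
lam |U| / 2 <= 2 |F| + 2 d |N| fails when lam >= 2 d / (log |S|)^c. *)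
Lemma log_densest_expander lam d c S :
  S \subset vertices G -> (max_degree G)%:R <= d -> 0 < d ->
  0 < log2 #|S|%:R :> R -> log_densest lam S ->
  2 * d / log2 #|S|%:R `^ c <= lam ->
  expander (1 / 8) c (d / (4 * log2 #|S|%:R `^ c)) (induced G S).
Proof.
move=> SG dG d0 lS Sd dlam U F /=; rewrite vertices_induced => US FE U0 US3 FU.
set P := log2 _ `^ c in dlam FU *.
have P0 : 0 < P by rewrite powR_gt0.
have lam0 : 0 <= lam by apply: le_trans dlam; rewrite divr_ge0 ?ltW ?mulr_gt0.
set N := nbhd _ U; rewrite leNgt; apply/negP => NU.
have NSU : N \subset S :\: U by apply/subsetP => v; rewrite inE => /andP[].
have NS : N \subset S by apply: subset_trans NSU (subsetDl _ _).
have WS : S :\: (U :|: N) \subset S by apply: subsetDl.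
have u0 : 0 < #|U|%:R :> R by rewrite ltr0n.
have hS : (#|S| = #|U| + #|N| + #|S :\: (U :|: N)|)%N.
  rewrite -(cardsID (U :|: N) S); congr (_ + _)%N.
  rewrite (setIidPr _) ?subUset ?US // cardsU.
  suff -> : U :&: N = set0 by rewrite cards0 subn0.
  apply/eqP; rewrite setI_eq0 disjoint_sym disjoints_subset.
  by apply: subset_trans NSU _; rewrite setDE subsetIr.
have eU : 2 * (edge_count G U)%:R
    <= (avg_degree R (induced G S) - lam / 2) * #|U|%:R.
  rewrite -avg_degree_inducedM ler_wpM2r //.
  have /Sd.2 := US; rewrite -cards_eq0 -lt0n => /(_ U0).
  have := ler_wpM2l lam0 (log2_le_sub u0 US3); lra.
have eW := log_densest_max lam0 Sd WS.
have := edge_count_cut US (erefl N).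
rewrite -(ler_nat R) !natrD => eS.
have eN := sum_degree_le (subset_trans NS SG) dG.
have := avg_degree_inducedM S; rewrite hS !natrD => DS.
have D0 := avg_degree_ge0 (induced G S).
(* In terms of y the bounds on |F|, |N| and lam |U| become linear. *)
have [y ydef] : exists y, y = #|U|%:R / P by exists (#|U|%:R / P).
have y0 : 0 < y by rewrite ydef divr_gt0.
have Fy : #|F|%:R <= d * y / 4.
  apply: le_trans FU _; rewrite le_eqVlt; apply/orP; left; apply/eqP.
  by rewrite ydef; field; rewrite gt_eqF.
have Ny : #|N|%:R < y / 8.
  by apply: lt_le_trans NU _; rewrite ydef; lra.
have ly : 2 * (d * y) <= lam * #|U|%:R.
  have -> : 2 * (d * y) = 2 * d / P * #|U|%:R by rewrite ydef; ring.
  by rewrite ler_pM2r.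
have dN : d * #|N|%:R <= d * (y / 8) by rewrite ler_pM2l // ltW.
have dy : 0 < d * y by rewrite mulr_gt0.
have DN : 0 <= avg_degree R (induced G S) * #|N|%:R by rewrite mulr_ge0.
lra.
Qed.

Definition deficiency (d : R) S : R := d * #|S|%:R - 2 * (edge_count G S)%:R.

Lemma deficiencyE d S :
  deficiency d S = (d - avg_degree R (induced G S)) * #|S|%:R.
Proof. by rewrite mulrBl avg_degree_inducedM. Qed.

Lemma deficiency_ge0 d S : S \subset vertices G ->
  (max_degree G)%:R <= d -> 0 <= deficiency d S.
Proof.
move=> SG dG; have := sum_degree_le SG dG.
have := edge_count_setD G (subxx S).
rewrite setDv edge_count0 -(ler_nat R) !natrD /deficiency; lra.
Qed.

Lemma deficiency_setD d A S : S \subset A -> S \subset vertices G ->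
  (max_degree G)%:R <= d ->
  deficiency d (A :\: S) <= deficiency d A + deficiency d S.
Proof.
move=> SA SG dG; have := sum_degree_le SG dG.
have := edge_count_setD G SA.
have := cardsID S A; rewrite (setIidPr SA) => cA.
rewrite -(ler_nat R) !natrD /deficiency -cA natrD; lra.
Qed.

(** A maximiser over all nonempty subsets of A is log-densest, and comparing it
with A itself bounds f(S) / |S|, as log |S| >= 0. *)
Lemma exists_log_densest d lam A : 0 <= lam -> A != set0 ->
  exists S, [/\ S \subset A, log_densest lam S &
    deficiency d S * #|A|%:R
      <= #|S|%:R * (deficiency d A + lam * log2 #|A|%:R * #|A|%:R)].
Proof.
move=> lam0 A0.
pose f S : R := avg_degree R (induced G S) - lam * log2 #|S|%:R.
have PA : (A \subset A) && (A != set0) by rewrite subxx.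
have [S /andP[SA S0] Smax] := @arg_maxP _ R _ A
  (fun S => (S \subset A) && (S != set0)) f PA.
exists S; split => //.
  split=> // B BS B0; apply: Smax; by rewrite (subset_trans BS SA).
have := Smax A PA; rewrite /f !deficiencyE => fA.
have l0 : 0 <= lam * log2 #|S|%:R :> R.
  by rewrite mulr_ge0 // log2_ge0 // ler1n card_gt0.
have -> : (d - avg_degree R (induced G S)) * #|S|%:R * #|A|%:R
  = #|S|%:R * #|A|%:R * (d - avg_degree R (induced G S)) by ring.
rewrite -mulrDl mulrA [X in _ <= X]mulrAC ler_wpM2l ?mulr_ge0 //.
rewrite /= in fA; lra.
Qed.

(** With z = f(A) / |A| + mu for the current set A, the next piece S has
f(S) <= z |S|.  Passing to A \ S therefore changes z |A|^2 into at most
z (|A| + |S|) (|A| - |S|) <= z |A|^2, so Z stays a bound.  While |A| > theta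
this gives f(S) / |S| <= z <= Z / theta^2. *)
Lemma log_densest_packing d lam mu theta Z A :
  (max_degree G)%:R <= d -> 0 <= lam -> 0 < theta ->
  A \subset vertices G -> lam * log2 #|A|%:R <= mu ->
  (deficiency d A + mu * #|A|%:R) * #|A|%:R <= Z ->
  exists P : {set {set T}},
    [/\ trivIset P,
        forall S, S \in P -> [/\ S \subset A, log_densest lam S &
          deficiency d S * theta ^+ 2 <= #|S|%:R * Z]
      & #|A|%:R - theta <= (\sum_(S in P) #|S|)%:R].
Proof.
move=> dG lam0 theta0.
have [n] := ubnP #|A|; elim: n A => // n IH A An AG lA ZA.
have [Ath|Ath] := lerP #|A|%:R theta.
  exists set0; split; [|by move=> S; rewrite inE|].
    by apply/trivIsetP => S B; rewrite inE.
  by rewrite big_set0; lra.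
have a0 : 0 < #|A|%:R :> R by lra.
have A0 : A != set0 by rewrite -card_gt0 -(ltr_nat R).
have [S [SA Sd Sdef]] := exists_log_densest d lam0 A0.
have S0 := Sd.1.
have SG := subset_trans SA AG.
have cA := cardsID S A; rewrite (setIidPr SA) in cA.
have cAR : #|A|%:R = #|S|%:R + #|A :\: S|%:R :> R by rewrite -natrD cA.
have fA0 := deficiency_ge0 AG dG.
have mu0 : 0 <= mu.
  by apply: le_trans lA; rewrite mulr_ge0 // log2_ge0 // ler1n card_gt0.
set z := (deficiency d A + mu * #|A|%:R) in ZA.
have z0 : 0 <= z by rewrite addr_ge0 ?mulr_ge0.
have Sz : deficiency d S * #|A|%:R <= #|S|%:R * z.
  apply: le_trans Sdef _; rewrite ler_wpM2l // lerD2l ler_wpM2r //.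
have [] := IH (A :\: S).
- rewrite -cA ltnS in An; apply: leq_trans An.
  by rewrite -add1n leq_add2r card_gt0.
- by apply: subset_trans AG; apply: subsetDl.
- apply: le_trans lA; rewrite ler_wpM2l // ler_log2_nat //.
  by rewrite subset_leq_card // subsetDl.
- have dD := deficiency_setD SA SG dG.
  apply: le_trans ZA.
  have -> : mu * #|A :\: S|%:R = mu * #|A|%:R - mu * #|S|%:R.
    by rewrite cAR; ring.
  set r' := #|A :\: S|%:R : R; have r0 : 0 <= r' by [].
  have s0 : 0 <= #|S|%:R :> R by [].
  have bound : deficiency d (A :\: S) + (mu * #|A|%:R - mu * #|S|%:R)
               <= z + deficiency d S.
    by rewrite /z; have := mulr_ge0 mu0 s0; lra.
  apply: le_trans (ler_wpM2r r0 bound) _.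
  have fs : deficiency d S * r' <= #|S|%:R * z.
    apply: le_trans Sz; rewrite ler_wpM2l ?deficiency_ge0 //.
    by rewrite cAR -/r'; lra.
  rewrite mulrDl cAR -/r'; lra.
move=> P [trivP Pgood Psum].
have dSP : {in P, forall B, [disjoint S & B]}.
  move=> B /Pgood[BAS _ _]; rewrite disjoint_sym disjoints_subset.
  by apply: subset_trans BAS _; rewrite setDE subsetIr.
have P0 : set0 \notin P.
  by apply/negP => /Pgood[_ [/eqP]].
have [trivSP SP] := trivIsetU1 dSP trivP P0.
exists (S |: P); split => //.
- move=> B /setU1P[->|/Pgood[BAS Bd BZ]]; split=> //.
  + have Z0 : z * #|A|%:R <= Z by [].
    have : deficiency d S * #|A|%:R ^+ 2 <= #|S|%:R * Z.
      apply: le_trans (ler_wpM2l (ler0n _ _) Z0).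
      by rewrite expr2 !mulrA ler_wpM2r.
    apply: le_trans; rewrite ler_wpM2l ?deficiency_ge0 //.
    by rewrite lerXn2r ?nnegrE //; lra.
  + by apply: subset_trans BAS (subsetDl _ _).
- by rewrite big_setU1 //= natrD; move: Psum; lra.
Qed.
End Densest.

(** * Iterating the packing *)

Lemma trivIset_bigcup (T : finType) (P : {set {set T}})
    (Q : {set T} -> {set {set T}}) :
  trivIset P ->
  (forall S, S \in P -> trivIset (Q S) /\ forall A, A \in Q S -> A \subset S) ->
  trivIset (\bigcup_(S in P) Q S) /\
  (\sum_(S in P) \sum_(A in Q S) #|A| <=
     \sum_(A in \bigcup_(S in P) Q S) #|A|)%N.
Proof.
move=> trivP PQ.
have trivQ : trivIset (\bigcup_(S in P) Q S).
  apply/trivIsetP => A B /bigcupP[S SP AS] /bigcupP[S' SP' BS] AB.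
  have [eS|neS] := eqVneq S S'.
    by subst S'; move/trivIsetP: (PQ S SP).1; apply.
  have /trivIsetP/(_ _ _ SP SP' neS) := trivP.
  by apply: disjointW; [apply: (proj2 (PQ S SP))|apply: (proj2 (PQ S' SP'))].
split=> //; rewrite (eqP trivQ).
have /= sumP := @big_trivIset _ _ _ addn P
  (fun x => (x \in cover (\bigcup_(S in P) Q S)) : nat) trivP.
apply: (@leq_trans
  (\sum_(x in cover P) (x \in cover (\bigcup_(S in P) Q S)))%N).
  rewrite sumP; apply: leq_sum => S SP.
  have [trivS QS] := PQ S SP; rewrite (eqnP trivS) -sum1_card.
  rewrite big_mkcond [X in (_ <= X)%N]big_mkcond; apply: leq_sum => x _.
  case: ifP => // /bigcupP[A AQ xA].
  rewrite (subsetP (QS _ AQ)) // lt0b.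
  by apply/bigcupP; exists A => //; apply/bigcupP; exists S.
rewrite -sum1_card big_mkcond [X in (_ <= X)%N]big_mkcond.
apply: leq_sum => x _.
by case: (x \in cover P); case: (x \in _).
Qed.

Section Main.
Variables (R : realType) (T : finType) (G : sgraph T).
Implicit Types (A S : {set T}).

Lemma induced_vertices : induced G (vertices G) = G.
Proof.
apply: val_inj; rewrite /= [RHS]surjective_pairing; congr pair.
apply/setP => e; rewrite inE andb_idr // => /edgesP[] //.
Qed.

Definition good_part (d c b : R) A : Prop :=
  let H := induced G A in
  [/\ (1 < #|A|)%N,
      expander (1 / 8) c (d / (4 * log2 #|A|%:R `^ c)) H,
      d * (1 - log2 #|A|%:R `^ (- b)) <= avg_degree R H &
      avg_degree R H / 2 <= (min_degree H)%:R].

(** Induction on |S|, with one packing at the scale l = log |S| and recursion in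
the pieces below the scale l^rho.  The term (log |S|)^(-alpha) in the coverage
makes the losses telescope: a recursion gains at least l^(-alpha) from it, by
the second inequality on scales, and this pays for what the packing at scale l
leaves uncovered.  The lower bound L on all scales survives because a piece of
average degree at least d / 2 has at least d / 2 vertices. *)
Lemma exists_good_parts (alpha C b d L : R) :
  0 < alpha -> 1 <= b -> b < C - 1 ->
  (forall l, L <= l ->
    [/\ 4 <= l, 2 * l `^ (- alpha) <= l `^ (- (alpha * (b / (C - 1)))) &
        3 * l `^ (1 - C + 2 * alpha) <= l `^ (- b)]) ->
  0 < d -> (max_degree G)%:R <= d -> L <= log2 (d / 2) ->
  forall S, S \subset vertices G -> L <= log2 #|S|%:R ->
    deficiency G d S <= d * #|S|%:R * log2 #|S|%:R `^ (- (C - 1)) ->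
  exists P : {set {set T}},
    [/\ trivIset P,
        forall A, A \in P -> A \subset S /\ good_part d (C * (C - 1) / b) b A
      & (1 - 2 * L `^ (- alpha) + log2 #|S|%:R `^ (- alpha)) * #|S|%:R
          <= (\sum_(A in P) #|A|)%:R].
Proof.
move=> alpha0 b1 bC scale d0 dG Ld S.
have [n] := ubnP #|S|; elim: n S => // n IH S Sn SG LS defS.
set c := C * (C - 1) / b.
set rho := b / (C - 1).
have C10 : 0 < C - 1 by lra.
have b0 : 0 < b by lra.
have rho0 : 0 < rho by rewrite divr_gt0.
have rho1 : rho <= 1 by rewrite ler_pdivrMr // mul1r ltW.
have [L4 LL _] := scale L (lexx _).
set l := log2 #|S|%:R in LS defS *.
have [l4 l_alpha l_b] := scale l LS.
have l0 : 0 < l by lra.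
have ln0 : l != 0 by rewrite gt_eqF.
have L0 : 0 < L by lra.
have S1 : (1 < #|S|)%N by apply: (@log2_nat_gt0 R); rewrite -/l.
have s0 : 0 < #|S|%:R :> R by rewrite ltr0n ltnW.
set t := l `^ (- alpha) in l_alpha *.
have t0 : 0 < t by rewrite powR_gt0.
set lam := 2 * d * l `^ (- C).
have lam0 : 0 <= lam by rewrite mulr_ge0 ?powR_ge0 // mulr_ge0 // ltW.
have lamM : lam * l = 2 * d * l `^ (1 - C).
  by rewrite /lam addrC powRD ?ln0 ?implybT // powRr1 ?mulrA // ltW.
have theta0 : 0 < t * #|S|%:R by rewrite mulr_gt0.
have Zle : (deficiency G d S + lam * l * #|S|%:R) * #|S|%:R
    <= 3 * d * l `^ (1 - C) * #|S|%:R ^+ 2.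
  rewrite expr2 mulrA ler_wpM2r // lamM.
  by move: defS; rewrite opprB; lra.
have [P [trivP Pdense Psum]] :=
  log_densest_packing dG lam0 theta0 SG (lexx (lam * l)) Zle.
have partP A : A \in P ->
  [/\ d * (1 - l `^ (- b)) <= avg_degree R (induced G A),
      deficiency G d A <= d * #|A|%:R * l `^ (- b) & L <= log2 #|A|%:R].
  move=> AP; have [AS Ad fA] := Pdense _ AP.
  have a0 : 0 < #|A|%:R :> R by rewrite ltr0n card_gt0 Ad.1.
  have dA : deficiency G d A <= d * #|A|%:R * l `^ (- b).
    have da0 : 0 <= d * #|A|%:R by rewrite mulr_ge0 // ltW.
    apply: le_trans (ler_wpM2l da0 l_b).
    have th2 : 0 < (t * #|S|%:R) ^+ 2 by rewrite exprn_gt0.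
    rewrite -(ler_pM2r th2); apply: le_trans fA _.
    rewrite le_eqVlt; apply/orP; left; apply/eqP.
    have tt : t ^+ 2 * l `^ (2 * alpha) = 1.
      rewrite /t expr2 -!powRD ?ln0 ?implybT //.
      have -> : - alpha + - alpha + 2 * alpha = 0 by ring.
      by rewrite powRr0.
    rewrite (@powRD _ _ (1 - C) (2 * alpha)) ?ln0 ?implybT //.
    transitivity (3 * d * l `^ (1 - C) * #|A|%:R * #|S|%:R ^+ 2
                  * (t ^+ 2 * l `^ (2 * alpha))); last by ring.
    by rewrite tt; ring.
  have avgA : d * (1 - l `^ (- b)) <= avg_degree R (induced G A).
    move: dA; rewrite deficiencyE mulrAC ler_pM2r //; lra.
  split=> //; apply: le_trans Ld _; apply: ler_log2; first by rewrite divr_gt0.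
  have := avg_degree_le_vertices R (induced G A).
  apply: le_trans; apply: le_trans avgA.
  by rewrite ler_pM2l //; have := powRN_le_quarter l4 b1; lra.
have refine A : exists Q : {set {set T}}, A \in P ->
  [/\ trivIset Q, forall B, B \in Q -> B \subset A /\ good_part d c b B &
      (1 - 2 * L `^ (- alpha) + 2 * t) * #|A|%:R <= (\sum_(B in Q) #|B|)%:R].
  have [AP|AP] := boolP (A \in P); last by exists set0.
  have [AS Ad _] := Pdense A AP.
  have [avgA dA LA] := partP A AP.
  have AG := subset_trans AS SG.
  set p := log2 #|A|%:R in LA.
  have p0 : 0 < p by lra.
  have pl : p <= l by rewrite ler_log2_nat // subset_leq_card.
  have lrho0 : 0 < l `^ rho by rewrite powR_gt0.
  have [lp|pl'] := lerP (l `^ rho) p.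
    exists [set A] => _; split.
    - exact: trivIset1.
    - move=> B /set1P ->; split=> //; split.
      + exact: (@log2_nat_gt0 R).
      + apply: log_densest_expander Ad _ => //.
        rewrite /lam ler_wpM2l ?mulr_ge0 ?(ltW d0) //.
        have -> : C = rho * c by rewrite /rho /c; field; rewrite !gt_eqF.
        rewrite -mulrN (powRrM l) -powRN.
        apply: powRN_le => //; rewrite /c divr_ge0 ?mulr_ge0 //; lra.
      + apply: le_trans avgA; rewrite ler_pM2l //.
        by have := @powRN_le R b _ _ (ltW b0) p0 pl; lra.
      + exact: log_densest_min_degree Ad.
    - rewrite big_set1; have := @powRN_le R alpha _ _ (ltW alpha0) L0 LS.
      by rewrite -/t => tL; rewrite -[X in _ <= X]mul1r ler_wpM2r //; lra.
  have pl1 : p < l.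
    apply: lt_le_trans pl' _; rewrite -[X in _ <= X]powRr1 ?(ltW l0) //.
    by apply: ler_powR => //; lra.
  have [] := IH A _ AG LA.
  - rewrite ltnS in Sn; apply: leq_trans Sn; rewrite ltnNge; apply/negP => SA.
    by have := ler_log2_nat R SA; rewrite -/p -/l; lra.
  - apply: le_trans dA _; rewrite ler_wpM2l ?mulr_ge0 ?(ltW d0) //.
    have -> : - b = rho * (- (C - 1)) by rewrite /rho; field; rewrite gt_eqF.
    by rewrite powRrM; apply: powRN_le => //; apply: ltW.
  move=> Q [trivQ Qgood Qsum]; exists Q => _; split=> //.
  apply: le_trans Qsum; rewrite ler_wpM2r // lerD2l.
  apply: le_trans l_alpha _; rewrite -mulrN mulrC -/rho.
  have -> : - rho * alpha = rho * (- alpha) by ring.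
  by rewrite powRrM; apply: powRN_le => //; apply: ltW.
have [Q Qprop] := choice refine.
have [|trivQ leQ] := trivIset_bigcup (P := P) (Q := Q) trivP.
  move=> A AP; have [trivQA QA _] := Qprop A AP; split=> // B BQ.
  by have [] := QA B BQ.
exists (\bigcup_(A in P) Q A); split=> //.
  move=> B /bigcupP[A AP BQ]; have [_ QA _] := Qprop A AP.
  have [BA Bgood] := QA B BQ; split=> //; apply: subset_trans BA _.
  by have [] := Pdense A AP.
set a := 2 * L `^ (- alpha) - 2 * t.
have a0 : 0 <= a.
  by have := @powRN_le R alpha _ _ (ltW alpha0) L0 LS; rewrite /a -/t; lra.
have a1 : 0 <= 1 - a.
  have : L `^ (- (alpha * rho)) <= 1.
    rewrite -[X in _ <= X](powRr0 L); apply: ler_powR; first by lra.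
    by rewrite oppr_le0 mulr_ge0 // ltW.
  by rewrite /a; move: LL; rewrite -/rho; lra.
move: leQ; rewrite -(ler_nat R); apply: le_trans.
apply: (@le_trans _ _ ((1 - a) * (\sum_(A in P) #|A|)%:R)); last first.
  rewrite !natr_sum mulr_sumr; apply: ler_sum => A AP.
  have [_ _] := Qprop A AP; apply: le_trans.
  by rewrite ler_wpM2r // /a; lra.
apply: le_trans (ler_wpM2l a1 Psum).
have := mulr_ge0 a0 (ltW theta0); rewrite -/t /a; lra.
Qed.
End Main.

(* The conjunct (1 < #|vertices H|)%N makes explicit that log|V(H)| is positive,
   so that s_H and eps_H are meaningful. *)
Theorem lemma4p1 (R : realType) (alpha C : R) (halpha : 0 < alpha)
    (hC : Num.max (28 * alpha + 3) (56 * alpha + 1) <= C) :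
  exists n0 : nat, forall (n : nat) (eps d : R),
    (n0 <= n)%N ->
    2 * log2 n%:R <= d ->
    0 <= eps ->
    eps <= log2 n%:R `^ (- (C - 1)) ->
    let c := C * (C - 1) / (C - 28 * alpha - 1) in
    forall (T : finType) (G : sgraph T),
      #|vertices G| = n ->
      (max_degree G)%:R <= d ->
      d * (1 - eps) <= avg_degree R G ->
      exists Hs : {set sgraph T},
        [/\ forall H, H \in Hs -> subgraph H G,
            forall H1 H2, H1 \in Hs -> H2 \in Hs -> H1 != H2 ->
              [disjoint vertices H1 & vertices H2],
            forall H, H \in Hs ->
              let s_H := d / (4 * log2 #|vertices H|%:R `^ c) in
              let eps_H := log2 #|vertices H|%:R `^ (- (C - 28 * alpha - 1)) in
              [/\ (1 < #|vertices H|)%N,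
                  expander (1 / 8) c s_H H,
                  d * (1 - eps_H) <= avg_degree R H &
                  avg_degree R H / 2 <= (min_degree H)%:R]
          & (1 - log2 (log2 (log2 n%:R)) ^+ 2 / log2 (log2 n%:R) `^ alpha)
              * n%:R
            <= (\sum_(H in Hs) #|vertices H|)%:R].
Proof.
have [C28 _] : 28 * alpha + 3 <= C /\ 56 * alpha + 1 <= C.
  by move: hC; rewrite ge_max => /andP.
set b := C - 28 * alpha - 1.
have b1 : 1 <= b by rewrite /b; lra.
have b0 : 0 <= b by lra.
have bC : b < C - 1 by rewrite /b; lra.
have [L0 scale] := stage_scale halpha b0 bC erefl.
have [L4 _ _] := scale _ (lexx _).
(* For n >= 2^(2^k) the scale log log n is at least k. *)
have [k kL] : exists k : nat, L0 < k%:R.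
  by exists (Num.bound L0); apply: archi_boundP; lra.
exists (2 ^ (2 ^ k))%N => n eps d nlarge dlarge _ eps_small c T G Gn dG avgG.
set l := log2 n%:R in dlarge eps_small *.
have lk : 2 ^+ k <= l.
  rewrite -natrX -log2_pow2 -natrX; exact: ler_log2_nat.
have k2 : 0 < 2 ^+ k :> R by rewrite exprn_gt0.
set L := log2 l.
have Lk : L0 <= L.
  apply: le_trans (ltW kL) _; rewrite -[k%:R]log2_pow2; exact: ler_log2.
have lL : 4 <= l.
  apply: le_trans lk.
  have k4 : (2 <= k)%N by rewrite -(ler_nat R); lra.
  rewrite -[4]/((2 ^ 2)%N%:R) -natrX ler_nat; exact: leq_pexp2l.
have l0 : 0 < l by lra.
have d0 : 0 < d by lra.
have Ld : L <= log2 (d / 2) by apply: ler_log2 => //; lra.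
have eps4 : eps <= 1 / 4.
  by apply: le_trans eps_small _; apply: powRN_le_quarter => //; lra.
have Ln : L <= log2 #|vertices G|%:R.
  apply: le_trans Ld _; apply: ler_log2; first by rewrite divr_gt0.
  apply: le_trans (avg_degree_le_vertices R G); apply: le_trans avgG.
  by rewrite ler_pM2l //; lra.
have dV : deficiency G d (vertices G)
    <= d * #|vertices G|%:R * log2 #|vertices G|%:R `^ (- (C - 1)).
  rewrite deficiencyE induced_vertices mulrAC ler_wpM2r // Gn -/l.
  have := ler_wpM2l (ltW d0) eps_small; lra.
have scaleL x : L <= x -> _ := fun Lx => scale x (le_trans Lk Lx).
have [P [trivP Pgood Psum]] := exists_good_parts halpha b1 bC scaleL d0 dG Ld
  (subxx _) Ln dV.
exists [set induced G A | A in P]; split.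
- by move=> H /imsetP[A /Pgood[AV _] ->]; apply: subgraph_induced.
- move=> H1 H2 /imsetP[A AP ->] /imsetP[B BP ->] AB.
  rewrite !vertices_induced; apply: (trivIsetP trivP) => //.
  by apply: contraNneq AB => ->.
- by move=> H /imsetP[A /Pgood[_ Agood] ->].
- have inj_induced : injective (induced G).
    by move=> A B AB; rewrite -(vertices_induced G A) AB.
  rewrite big_imset /=; last by move=> A B _ _ /inj_induced.
  apply: le_trans Psum; rewrite Gn -/l ler_wpM2r //.
  have L'4 : 4 <= L by lra.
  (* The factor 2 in the total loss is absorbed by (log log log n)^2. *)
  have logL : 2 <= log2 L.
    rewrite -[2]log2_pow2; apply: ler_log2 => //; lra.
  have : 2 * L `^ (- alpha) <= log2 L ^+ 2 / L `^ alpha.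
    rewrite powRN ler_wpM2r ?invr_ge0 ?powR_ge0 //.
    by have := ler_wpM2l (le_trans (ler0n R 2) logL) logL; rewrite expr2; lra.
  have := powR_ge0 l (- alpha); lra.
Qed.
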